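(* Suppose that $\xi,\eta\in\mathrm{SL}(2,\mathbb{C})$ generate an irreducible representation and let $\zeta=\eta^{-1}\xi^{-1}$, so that $\xi\eta\zeta=\mathbb{I}$. Then there exists a unique triple of involutions $$\iota_{\xi\eta},\ \iota_{\eta\zeta},\ \iota_{\zeta\xi}\in\mathsf{Inv}$$ such that the corresponding elements $\mathbb{P}(\xi),\mathbb{P}(\eta),\mathbb{P}(\zeta)\in\mathrm{PSL}(2,\mathbb{C})$ satisfy $$\mathbb{P}(\xi)=\iota_{\zeta\xi}\,\iota_{\xi\eta},\qquad \mathbb{P}(\eta)=\iota_{\xi\eta}\,\iota_{\eta\zeta},\qquad \mathbb{P}(\zeta)=\iota_{\eta\zeta}\,\iota_{\zeta\xi}.$$
   Context: $\mathbb{I}$ is the identity matrix. $\mathbb{P}(\xi)$ denotes the image of $\xi\in\mathrm{SL}(2,\mathbb{C})$ in $\mathrm{PSL}(2,\mathbb{C})=\mathrm{SL}(2,\mathbb{C})/\{\pm\mathbb{I}\}$. An involution is an element of $\mathrm{PSL}(2,\mathbb{C})$ of order exactly two, and $\mathsf{Inv}\subset\mathrm{PSL}(2,\mathbb{C})$ is the set of all involutions. The pair $\xi,\eta$ generates an irreducible representation if the group $\langle\xi,\eta\rangle$ preserves no proper nonzero linear subspace of $\mathbb{C}^2$. *)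

(* Defs.v *)
From HB Require Import structures.
From mathcomp Require Import all_boot all_order all_algebra.
From mathcomp Require Import all_classical reals.
From mathcomp Require Import complex.

Set Implicit Arguments.
Unset Strict Implicit.
Unset Printing Implicit Defensive.

Import GRing.Theory.
Local Open Scope ring_scope.
Local Open Scope quotient_scope.

Record SL2 (F : fieldType) := MkSL2 {
  SL2_mx :> 'M[F]_2;
  det_SL2 : \det SL2_mx == 1 }.

HB.instance Definition _ (F : fieldType) := [isSub for @SL2_mx F].
HB.instance Definition _ (F : fieldType) := [Choice of SL2 F by <:].

Section SL2Group.
Variable F : fieldType.
Implicit Types x y z : SL2 F.

Fact SL2_mul_subproof x y : \det (SL2_mx x *m SL2_mx y) == 1.
Proof. by rewrite det_mulmx (eqP (det_SL2 x)) (eqP (det_SL2 y)) mulr1. Qed.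

Fact SL2_one_subproof : \det (1%:M : 'M[F]_2) == 1.
Proof. by rewrite det1. Qed.

Fact SL2_inv_subproof x : \det (invmx (SL2_mx x)) == 1.
Proof. by rewrite det_inv (eqP (det_SL2 x)) invr1. Qed.

Definition SL2_mul x y := MkSL2 (SL2_mul_subproof x y).
Definition SL2_one := MkSL2 SL2_one_subproof.
Definition SL2_inv x := MkSL2 (SL2_inv_subproof x).

Fact SL2_unit x : SL2_mx x \in unitmx.
Proof. by rewrite unitmxE (eqP (det_SL2 x)) unitr1. Qed.

Fact SL2_mulA : associative SL2_mul.
Proof. by move=> x y z; apply/val_inj; exact: mulmxA. Qed.
Fact SL2_mul1 : left_id SL2_one SL2_mul.
Proof. by move=> x; apply/val_inj; exact: mul1mx. Qed.
Fact SL2_mulr1 : right_id SL2_one SL2_mul.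
Proof. by move=> x; apply/val_inj; exact: mulmx1. Qed.
Fact SL2_mulV : left_inverse SL2_one SL2_inv SL2_mul.
Proof. by move=> x; apply/val_inj; exact: mulVmx (SL2_unit x). Qed.
Fact SL2_mulrV : right_inverse SL2_one SL2_inv SL2_mul.
Proof. by move=> x; apply/val_inj; exact: mulmxV (SL2_unit x). Qed.

HB.instance Definition _ := isGroup.Build (SL2 F)
  SL2_mulA SL2_mul1 SL2_mulr1 SL2_mulV SL2_mulrV.

Lemma SL2_mxM x y : SL2_mx (x * y)%g = SL2_mx x *m SL2_mx y.
Proof. by []. Qed.
Lemma SL2_mx1 : SL2_mx (1%g : SL2 F) = 1%:M.
Proof. by []. Qed.
Lemma SL2_mxV x : SL2_mx x^-1%g = invmx (SL2_mx x).
Proof. by []. Qed.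

Definition pmI : pred (SL2 F) :=
  fun x => (SL2_mx x == 1%:M) || (SL2_mx x == - 1%:M).

Lemma pmIP x :
  reflect (exists b : bool, SL2_mx x = (-1) ^+ b *: 1%:M) (pmI x).
Proof.
apply: (iffP orP) => [[] /eqP ->|[[] ->]].
- by exists false; rewrite scale1r.
- by exists true; rewrite scaleN1r.
- by right; rewrite scaleN1r.
- by left; rewrite scale1r.
Qed.

Lemma pmI1 : pmI 1%g. Proof. by rewrite /pmI eqxx. Qed.

Lemma pmIM x y : pmI x -> pmI y -> pmI (x * y)%g.
Proof.
move=> /pmIP[b xb] /pmIP[c yc]; apply/pmIP; exists (b (+) c).
by rewrite SL2_mxM xb yc -scalemxAl mul1mx scalerA signr_addb.
Qed.

Lemma pmI_comm x y : pmI x -> (x * y = y * x)%g.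
Proof.
move=> /pmIP[b xb]; apply/val_inj; rewrite /= xb.
by rewrite -scalemxAl -scalemxAr mul1mx mulmx1.
Qed.

Lemma pmIV x : pmI x -> pmI x^-1%g.
Proof.
move=> px; have /pmIP[b xb] := px; suff -> : (x^-1 = x)%g by [].
have xx : (x * x = 1)%g.
  apply/val_inj; rewrite /= xb -scalemxAl mul1mx scalerA.
  by rewrite -signr_addb addbb scale1r.
by apply: (@mulgI _ x); rewrite mulgV xx.
Qed.

(* x and y lie in the same coset of {I, -I}. *)
Definition PSL2_equiv : rel (SL2 F) := fun x y => pmI (x^-1 * y)%g.

Fact PSL2_equiv_refl : reflexive PSL2_equiv.
Proof. by move=> x; rewrite /PSL2_equiv mulVg pmI1. Qed.

Fact PSL2_equiv_sym : symmetric PSL2_equiv.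
Proof.
have S x y : PSL2_equiv x y -> PSL2_equiv y x.
  by move=> /pmIV; rewrite invgM invgK.
by move=> x y; apply/idP/idP; exact: S.
Qed.

Fact PSL2_equiv_trans : transitive PSL2_equiv.
Proof.
move=> y x z xy yz; have := pmIM xy yz.
by rewrite /PSL2_equiv -mulgA mulVKg.
Qed.

Canonical PSL2_equiv_equiv :=
  EquivRel PSL2_equiv PSL2_equiv_refl PSL2_equiv_sym PSL2_equiv_trans.

End SL2Group.

Definition PSL2 (F : fieldType) := {eq_quot (@PSL2_equiv F)}.

HB.instance Definition _ (F : fieldType) := Choice.on (PSL2 F).
HB.instance Definition _ (F : fieldType) := EqQuotient.on (PSL2 F).

Definition PSL2_proj (F : fieldType) (x : SL2 F) : PSL2 F := \pi_(PSL2 F) x.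

Section PSL2Group.
Variable F : fieldType.
Implicit Types (x y : SL2 F) (a b c : PSL2 F).

Definition PSL2_mul a b := PSL2_proj (repr a * repr b)%g.
Definition PSL2_one := PSL2_proj (1%g : SL2 F).
Definition PSL2_inv a := PSL2_proj (repr a)^-1%g.

Lemma PSL2_proj_eq x y : (PSL2_proj x == PSL2_proj y) = pmI (x^-1 * y)%g.
Proof. exact: piE. Qed.

Lemma PSL2_projP x y :
  PSL2_proj x = PSL2_proj y <-> SL2_mx y = SL2_mx x \/ SL2_mx y = - SL2_mx x.
Proof.
have -> : (PSL2_proj x = PSL2_proj y) <-> pmI (x^-1 * y)%g.
  by rewrite -PSL2_proj_eq; split=> /eqP.
split=> [/orP[]/eqP xy|yx].
- by left; rewrite -[y in LHS](mulVKg x) SL2_mxM xy mulmx1.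
- by right; rewrite -[y in LHS](mulVKg x) SL2_mxM xy mulmxN mulmx1.
- apply/orP; rewrite SL2_mxM SL2_mxV; case: yx => ->; [left|right].
  + by rewrite mulVmx ?SL2_unit.
  + by rewrite mulmxN mulVmx ?SL2_unit.
Qed.

Lemma PSL2_proj_repr a : PSL2_proj (repr a) = a.
Proof. exact: reprK. Qed.

Lemma PSL2_proj_ind (P : PSL2 F -> Prop) : (forall x, P (PSL2_proj x)) -> forall a, P a.
Proof. by move=> Px a; rewrite -[a]PSL2_proj_repr. Qed.

Lemma PSL2_proj_mulE x y : PSL2_proj (x * y)%g = PSL2_mul (PSL2_proj x) (PSL2_proj y).
Proof.
apply/esym/eqP; rewrite PSL2_proj_eq.
have := PSL2_proj_repr (PSL2_proj x); have := PSL2_proj_repr (PSL2_proj y).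
move: (repr (PSL2_proj x)) (repr (PSL2_proj y)) => x' y'.
move=> /eqP; rewrite PSL2_proj_eq => py /eqP; rewrite PSL2_proj_eq => px.
have -> : ((x' * y')^-1 * (x * y) = (x'^-1 * x) * (y'^-1 * y))%g.
  by rewrite invgM -mulgA (mulgA x'^-1%g) mulgA -(pmI_comm _ px) !mulgA.
exact: pmIM.
Qed.

Lemma PSL2_proj_invE x : PSL2_proj x^-1%g = PSL2_inv (PSL2_proj x).
Proof.
apply/esym/eqP; rewrite PSL2_proj_eq.
have := PSL2_proj_repr (PSL2_proj x); move: (repr (PSL2_proj x)) => x'.
move=> /eqP; rewrite PSL2_proj_eq invgK => px.
have -> : (x' * x^-1 = (x'^-1 * x)^-1)%g.
  by apply: (@mulIg _ x'); rewrite (pmI_comm _ (pmIV px)) invgM invgK mulgA.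
exact: pmIV.
Qed.

Fact PSL2_mulA : associative PSL2_mul.
Proof.
elim/PSL2_proj_ind=> x; elim/PSL2_proj_ind=> y; elim/PSL2_proj_ind=> z.
by rewrite -!PSL2_proj_mulE mulgA.
Qed.
Fact PSL2_mul1 : left_id PSL2_one PSL2_mul.
Proof. by elim/PSL2_proj_ind=> x; rewrite -PSL2_proj_mulE mul1g. Qed.
Fact PSL2_mulr1 : right_id PSL2_one PSL2_mul.
Proof. by elim/PSL2_proj_ind=> x; rewrite -PSL2_proj_mulE mulg1. Qed.
Fact PSL2_mulV : left_inverse PSL2_one PSL2_inv PSL2_mul.
Proof. by elim/PSL2_proj_ind=> x; rewrite -PSL2_proj_invE -PSL2_proj_mulE mulVg. Qed.
Fact PSL2_mulrV : right_inverse PSL2_one PSL2_inv PSL2_mul.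
Proof. by elim/PSL2_proj_ind=> x; rewrite -PSL2_proj_invE -PSL2_proj_mulE mulgV. Qed.

HB.instance Definition _ := isGroup.Build (PSL2 F)
  PSL2_mulA PSL2_mul1 PSL2_mulr1 PSL2_mulV PSL2_mulrV.

Fact PSL2_proj_monoid_morphism : monoid.monoid_morphism (@PSL2_proj F).
Proof. by split=> // x y; rewrite PSL2_proj_mulE. Qed.

HB.instance Definition _ :=
  isUMagmaMorphism.Build (SL2 F) (PSL2 F) (@PSL2_proj F) PSL2_proj_monoid_morphism.

End PSL2Group.

Section Definitions.
Local Open Scope classical_set_scope.

(* Order exactly two: the identity is excluded. *)
Definition involutions (F : fieldType) : set (PSL2 F) :=
  [set a | a <> 1%g /\ (a ^+ 2)%g = 1%g].

Definition is_subgroup (G : groupType) (H : set G) : Prop :=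
  [/\ H 1%g, forall x y, H x -> H y -> H (x * y)%g
    & forall x, H x -> H x^-1%g].

Definition generated (G : groupType) (S : set G) : set G :=
  smallest (@is_subgroup G) S.

(* SL(2, F) acts on column vectors by left multiplication. *)
Definition preserves_subspace (F : fieldType) (H : set (SL2 F))
    (V : {vspace 'cV[F]_2}) : Prop :=
  forall g : SL2 F, H g -> forall v, v \in V -> SL2_mx g *m v \in V.

Definition irreducible_pair (F : fieldType) (x y : SL2 F) : Prop :=
  ~ exists V : {vspace 'cV[F]_2},
      [/\ V != 0%VS, V != fullv
        & preserves_subspace (generated [set x; y]) V].

End Definitions.

(* Main.v *)
Require Import Defs.
From HB Require Import structures.
From mathcomp Require Import all_boot all_order all_algebra.
From mathcomp Require Import all_classical reals.
From mathcomp Require Import complex.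
From mathcomp Require Import ring.

(** An element of PSL(2) over a field of characteristic other than 2 is an
    involution exactly when its lifts to SL(2) have trace zero
    ([involution_projE]).  Since involutions are their own inverses, the three
    factorizations amount to choosing one involution i = iota_{xi eta} such that
    P(xi) i and i P(eta) are involutions as well: these two are then the other
    members of the triple, and the factorization of P(zeta) is automatic
    ([mul_inverted]).  In terms of a lift M of i, the requirement is linear:
    M must be orthogonal to I, xi and eta for the trace form.

    The Lie product L = xi eta - eta xi is orthogonal to all three, so what
    remains is that L is invertible, whence a multiple of it has determinant 1,
    and that M is determined up to sign.  Both come from Schur's lemma: a matrix
    M orthogonal to I and to a matrix A satisfies M A = adj(A) M
    ([traceless_intertwine]), and so intertwines the representation with the
    pair (adj xi, adj eta).  Intertwiners from an irreducible pair are zero or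
    invertible ([schur]), and over an algebraically closed field any two are
    proportional ([schur_proportional]).  Two candidates of determinant 1 are
    thus proportional by a factor of square 1.  Finally L is not zero, because
    otherwise xi and eta would commute and Schur's lemma would make both of them
    scalar ([lie_neq0]). *)

Set Implicit Arguments.
Unset Strict Implicit.
Unset Printing Implicit Defensive.

Import GRing.Theory Num.Theory.
Local Open Scope ring_scope.

(** * Matrices of size two *)

Lemma ord2E (i : 'I_2) : i = 0 \/ i = 1.
Proof. by case: i => [[|[|//]] i2]; [left | right]; apply: val_inj. Qed.

Lemma big_ord2 (V : nmodType) (f : 'I_2 -> V) : \sum_i f i = f 0 + f 1.
Proof.
by rewrite !big_ord_recl big_ord0 addr0 (_ : lift 0 0 = 1) //; apply: val_inj.
Qed.

Lemma mx2P (T : Type) (A B : 'M[T]_2) :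
  A 0 0 = B 0 0 -> A 0 1 = B 0 1 -> A 1 0 = B 1 0 -> A 1 1 = B 1 1 -> A = B.
Proof.
move=> e00 e01 e10 e11; apply/matrixP => i j.
by case: (ord2E i) => ->; case: (ord2E j) => ->.
Qed.

Lemma mulmx2E (R : pzSemiRingType) (A B : 'M[R]_2) i j :
  (A *m B) i j = A i 0 * B 0 j + A i 1 * B 1 j.
Proof. by rewrite mxE big_ord2. Qed.

Lemma mxtrace2E (R : pzSemiRingType) (A : 'M[R]_2) : \tr A = A 0 0 + A 1 1.
Proof. exact: big_ord2. Qed.

Lemma det2E (R : comPzRingType) (A : 'M[R]_2) :
  \det A = A 0 0 * A 1 1 - A 0 1 * A 1 0.
Proof.
rewrite (expand_det_row _ 0) big_ord2 /cofactor !det_mx11 !mxE.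
have -> : lift 0 0 = 1 :> 'I_2 by apply: val_inj.
have -> : lift 1 0 = 0 :> 'I_2 by apply: val_inj.
by rewrite /= expr0 expr1 mul1r mulN1r mulrN.
Qed.

(** In size two the adjugate is [(\tr A)%:M - A], so this is the
    Cayley-Hamilton theorem; it makes inverses in SL(2) affine in the matrix. *)
Lemma mulmx_adj2 (R : comPzRingType) (A : 'M[R]_2) :
  A *m ((\tr A)%:M - A) = (\det A)%:M.
Proof.
by apply: mx2P; rewrite mulmx2E !mxE mxtrace2E det2E /= ?mulr1n ?mulr0n; ring.
Qed.

(** The two sides differ by [(\tr (M *m A))%:M]: for traceless M, the matrix
    M A - adj(A) M equals M A + adj(M A), which is scalar. *)
Lemma traceless_intertwine (R : comPzRingType) (M A : 'M[R]_2) :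
  \tr M = 0 -> \tr (M *m A) = 0 -> M *m A = ((\tr A)%:M - A) *m M.
Proof.
move=> trM trMA; rewrite -[RHS]addr0 -[in RHS](raddf0 (@scalar_mx R 2)) -trMA.
have M11 : M 1 1 = - M 0 0.
  by apply/eqP; rewrite -addr_eq0 addrC -mxtrace2E trM.
apply: mx2P; rewrite [RHS]mxE !mulmx2E !mxE !mxtrace2E !mulmx2E M11 /=.
all: by rewrite ?mulr1n ?mulr0n; ring.
Qed.

Lemma SL2_mxV_adj (F : fieldType) (x : SL2 F) :
  SL2_mx x^-1%g = (\tr (SL2_mx x))%:M - SL2_mx x.
Proof.
apply: (can_inj (mulKmx (SL2_unit x))).
by rewrite SL2_mxV mulmxV ?SL2_unit // mulmx_adj2 (eqP (det_SL2 x)).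
Qed.

(** * Involutions *)

(** By Cayley-Hamilton a square root of -I in SL(2) has trace zero, since
    x + x^-1 is the scalar tr x.  A square root of I is instead its own inverse,
    so that 2 x is scalar and x represents the identity of PSL(2). *)
Lemma involution_projE (F : fieldType) (x : SL2 F) : 2 != 0 :> F ->
  involutions (PSL2_proj x) <-> \tr (SL2_mx x) = 0.
Proof.
move=> nz2.
have trV : (\tr (SL2_mx x))%:M = SL2_mx x + SL2_mx x^-1%g.
  by rewrite SL2_mxV_adj addrC subrK.
have sqE : (PSL2_proj x ^+ 2)%g = PSL2_proj (x * x)%g.
  by rewrite expgS expg1 PSL2_proj_mulE.
have invE : (PSL2_proj x ^+ 2)%g = 1%g <-> PSL2_proj x^-1%g = PSL2_proj x.
  rewrite sqE !PSL2_proj_mulE; split=> [xx|xx].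
    by rewrite PSL2_proj_invE; apply: (@mulgI _ (PSL2_proj x)); rewrite mulgV.
  by rewrite -[X in PSL2_mul X _]xx -PSL2_proj_mulE mulVg.
split=> [[x1 /invE/PSL2_projP[xV|xV]]|tr0].
- case: x1; apply/PSL2_projP; rewrite SL2_mx1.
  move: trV; rewrite -xV => trV.
  set t := \tr (SL2_mx x) in trV.
  have xE : SL2_mx x^-1%g = (t / 2)%:M.
    apply: (scalerI nz2); rewrite scale_scalar_mx mulrC divfK // trV.
    by rewrite xV scaler_nat mulr2n.
  have : \det (SL2_mx x) == 1 by exact: det_SL2.
  rewrite xV xE det_scalar sqrf_eq1 => /orP[]/eqP->; [left | right] => //.
  by rewrite raddfN opprK.
- have /matrixP/(_ 0 0): (\tr (SL2_mx x))%:M = 0 :> 'M[F]_2.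
    by rewrite trV xV addNr.
  by rewrite !mxE mulr1n.
split; last first.
  apply/invE/PSL2_projP; right; apply/eqP; rewrite -addr_eq0 -trV tr0.
  by rewrite raddf0.
move/PSL2_projP; rewrite SL2_mx1 => -[] /(congr1 mxtrace)/eqP.
  by rewrite mxtrace1 tr0 (negPf nz2).
by rewrite mxtrace1 raddfN /= tr0 oppr0 (negPf nz2).
Qed.

Lemma involution_inv (F : fieldType) (i : PSL2 F) :
  involutions i -> (i^-1 = i)%g.
Proof.
case=> _; rewrite expgS expg1 => ii.
by apply: (@mulgI _ i); rewrite mulgV ii.
Qed.

(** The hypotheses say that conjugation by i inverts x and y, and the
    right-hand side is the conjugate of y x by i. *)
Lemma mul_inverted (G : groupType) (i x y : G) :
  (i^-1 = i -> (x * i)^-1 = x * i -> (i * y)^-1 = i * y ->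
   y^-1 * x^-1 = (i * y) * (x * i))%g.
Proof.
move=> iV xiV iyV; rewrite -xiV -iyV !invgM iV.
by rewrite -mulgA (mulgA i) -[X in (X * i)%g]iV mulVg mul1g.
Qed.

(** * Schur's lemma *)

Lemma stabilizer_subgroup (F : fieldType) (V : {vspace 'cV[F]_2}) :
  is_subgroup [set g : SL2 F | forall v, v \in V -> SL2_mx g *m v \in V]%classic.
Proof.
split=> [v vV|g h gV hV v vV|g gV v vV].
- by rewrite mul1mx.
- by rewrite -mulmxA; apply/gV/hV.
- by rewrite SL2_mxV_adj mulmxBl mul_scalar_mx rpredB ?rpredZ ?gV.
Qed.

(** The kernel of A is invariant under x and y, hence it is zero or the whole
    plane. *)
Lemma schur (F : fieldType) (x y : SL2 F) (x' y' A : 'M[F]_2) :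
  irreducible_pair x y ->
  A *m SL2_mx x = x' *m A -> A *m SL2_mx y = y' *m A ->
  \det A = 0 -> A = 0.
Proof.
move=> irr Ax Ay detA; apply: contra_notP irr => A0.
pose V := lker (linfun (mulmx A : 'cV[F]_2 -> 'cV[F]_2)).
have memV v : (v \in V) = (A *m v == 0) by rewrite memv_ker lfunE.
exists V; split.
- have /eqP/det0P[u u0 uA] : \det A^T = 0 by rewrite det_tr.
  apply: contraNneq u0 => V0.
  have : u^T \in V by rewrite memV -(trmxK A) -trmx_mul uA trmx0.
  by rewrite V0 memv0 trmx_eq0.
- apply/eqP => VT; apply: A0; apply/matrixP => i j.
  have : delta_mx j 0 \in V by rewrite VT memvf.
  by rewrite memV -colE => /eqP/matrixP/(_ i 0); rewrite !mxE.
- move=> g; move/(_ _ (conj (stabilizer_subgroup V) _)); apply.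
  have stab (z : SL2 F) z' : A *m SL2_mx z = z' *m A ->
      forall v, v \in V -> SL2_mx z *m v \in V.
    by move=> Az v; rewrite !memV mulmxA Az -mulmxA => /eqP->; rewrite mulmx0.
  by move=> z [] ->; [apply: stab Ax | apply: stab Ay].
Qed.

(** For k an eigenvalue of A B^-1, the intertwiner A - k B is singular, hence
    zero. *)
Lemma schur_proportional (C : numClosedFieldType) (x y : SL2 C)
    (x' y' A B : 'M[C]_2) :
  irreducible_pair x y -> B \in unitmx ->
  A *m SL2_mx x = x' *m A -> A *m SL2_mx y = y' *m A ->
  B *m SL2_mx x = x' *m B -> B *m SL2_mx y = y' *m B ->
  exists k, A = k *: B.
Proof.
move=> irr Bu Ax Ay Bx By.
have [k /eigenvalueP[u uAB u0]] := eigenvalue_closed (A *m invmx B) (ltn0Sn 1).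
exists k; apply/eqP; rewrite -subr_eq0; apply/eqP; apply: (schur irr).
- by rewrite mulmxBl mulmxBr -scalemxAl -scalemxAr Ax Bx.
- by rewrite mulmxBl mulmxBr -scalemxAl -scalemxAr Ay By.
apply/eqP/det0P; exists u => //.
by rewrite mulmxBr -scalemxAr -{1}(mulmxKV Bu A) mulmxA uAB -scalemxAl subrr.
Qed.

(** If xi and eta commuted, both would be scalar, and then every matrix would
    be an intertwiner, even a singular one. *)
Lemma lie_neq0 (C : numClosedFieldType) (x y : SL2 C) :
  irreducible_pair x y ->
  SL2_mx x *m SL2_mx y - SL2_mx y *m SL2_mx x != 0.
Proof.
move=> irr; rewrite subr_eq0; apply/eqP => xyC.
have scal z : z *m SL2_mx x = SL2_mx x *m z -> z *m SL2_mx y = SL2_mx y *m z ->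
    exists k, z = k%:M.
  move=> zx zy.
  have [] := @schur_proportional _ _ _ (SL2_mx x) (SL2_mx y) z 1%:M irr.
  all: rewrite ?unitmx1 ?mul1mx ?mulmx1 //.
  by move=> k ->; exists k; rewrite scalemx1.
have [a xa] : exists a, SL2_mx x = a%:M by exact: scal.
have [b yb] : exists b, SL2_mx y = b%:M by apply: scal.
have E0 : delta_mx 0 0 = 0 :> 'M[C]_2.
  apply: (@schur _ _ _ (SL2_mx x) (SL2_mx y) _ irr); rewrite ?xa ?yb ?scalar_mxC //.
  by rewrite det2E !mxE /= mulr0 mul0r subrr.
by move/matrixP/(_ 0 0)/eqP: E0; rewrite !mxE /= oner_eq0.
Qed.

(** * The triple of involutions *)

(** Orthogonality of M to I, x and y for the trace form (A, B) |-> tr(A B). *)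
Definition orthogonal_to_pair (F : fieldType) (x y : SL2 F) (M : 'M[F]_2) :=
  [/\ \tr M = 0, \tr (M *m SL2_mx x) = 0 & \tr (M *m SL2_mx y) = 0].

Lemma lie_orthogonal (F : fieldType) (x y : SL2 F) :
  orthogonal_to_pair x y (SL2_mx x *m SL2_mx y - SL2_mx y *m SL2_mx x).
Proof.
split; rewrite ?mulmxBl raddfB /=; apply/eqP; rewrite subr_eq0; apply/eqP.
- exact: mxtrace_mulC.
- by rewrite -mulmxA mxtrace_mulC.
- by rewrite -[in RHS]mulmxA [RHS]mxtrace_mulC.
Qed.

Lemma orthogonal_intertwine (F : fieldType) (x y : SL2 F) (M : 'M[F]_2) :
  orthogonal_to_pair x y M ->
  M *m SL2_mx x = SL2_mx x^-1%g *m M /\ M *m SL2_mx y = SL2_mx y^-1%g *m M.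
Proof. by case=> *; rewrite !SL2_mxV_adj -!traceless_intertwine. Qed.

Lemma exists_orthogonal (C : numClosedFieldType) (x y : SL2 C) :
  irreducible_pair x y -> exists m : SL2 C, orthogonal_to_pair x y (SL2_mx m).
Proof.
move=> irr; have /orthogonal_intertwine[Lx Ly] := lie_orthogonal x y.
have [] := lie_orthogonal x y; have := lie_neq0 irr.
move: (_ - _) Lx Ly => L Lx Ly L0 trL trLx trLy.
have dL : \det L != 0 by apply: contraNneq L0 => /(schur irr Lx Ly)->.
have dm : \det ((sqrtC (\det L))^-1 *: L) == 1.
  by rewrite detZ exprVn sqrtCK mulVf.
exists (MkSL2 dm); split; rewrite /= -?scalemxAl linearZ /=.
all: by rewrite ?trL ?trLx ?trLy mulr0.
Qed.

Lemma orthogonal_uniq (C : numClosedFieldType) (x y m n : SL2 C) :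
  irreducible_pair x y ->
  orthogonal_to_pair x y (SL2_mx m) -> orthogonal_to_pair x y (SL2_mx n) ->
  PSL2_proj m = PSL2_proj n.
Proof.
move=> irr /orthogonal_intertwine[mx my] /orthogonal_intertwine[nx ny].
have [k nE] := schur_proportional irr (SL2_unit m) nx ny mx my.
apply/PSL2_projP; move: (det_SL2 n).
rewrite nE detZ (eqP (det_SL2 m)) mulr1 sqrf_eq1 => /orP[]/eqP->.
  by left; rewrite scale1r.
by right; rewrite scaleN1r.
Qed.

(** This turns the search for the triple into linear algebra: each of the three
    classes is an involution when the trace of its lift vanishes. *)
Lemma orthogonal_involutions (F : fieldType) (x y m : SL2 F) : 2 != 0 :> F ->
  orthogonal_to_pair x y (SL2_mx m) <->
  [/\ involutions (PSL2_proj m), involutions (PSL2_proj x * PSL2_proj m)%g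
    & involutions (PSL2_proj m * PSL2_proj y)%g].
Proof.
move=> nz2; rewrite -[(PSL2_proj x * _)%g]PSL2_proj_mulE.
rewrite -[(_ * PSL2_proj y)%g]PSL2_proj_mulE.
have trC : \tr (SL2_mx (x * m)%g) = \tr (SL2_mx m *m SL2_mx x).
  by rewrite SL2_mxM mxtrace_mulC.
split=> -[].
  by move=> trm trmx trmy; split; apply/involution_projE; rewrite ?trC.
move=> /(involution_projE _ nz2) ? /(involution_projE _ nz2).
by rewrite trC => ? /(involution_projE _ nz2).
Qed.

Theorem theoremB (R : realType) (xi eta zeta : SL2 R[i])
    (irr : irreducible_pair xi eta) (zetaE : zeta = (eta^-1 * xi^-1)%g) :
  (xi * eta * zeta = 1)%g /\
  exists! iota : PSL2 R[i] * PSL2 R[i] * PSL2 R[i],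
    let: (i_xe, i_ez, i_zx) := iota in
    [/\ involutions i_xe, involutions i_ez & involutions i_zx] /\
    [/\ PSL2_proj xi = (i_zx * i_xe)%g,
        PSL2_proj eta = (i_xe * i_ez)%g
      & PSL2_proj zeta = (i_ez * i_zx)%g].
Proof.
have nz2 : 2 != 0 :> R[i] by rewrite pnatr_eq0.
split; first by rewrite zetaE -mulgA mulVKg mulgV.
(* m lifts iota_{xi eta}, which determines the other two involutions. *)
have [m om] := exists_orthogonal irr.
have /(orthogonal_involutions _ _ _ nz2)[im ixm imy] := om.
have mV := involution_inv im.
exists (PSL2_proj m, PSL2_proj m * PSL2_proj eta, PSL2_proj xi * PSL2_proj m)%g.
split=> [|[[i j] k] [[ii ij ik] [xiE etaE _]]].
  split=> //; split.
  - by rewrite -{2}mV mulgK.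
  - by rewrite -{1}mV mulKg.
  - rewrite zetaE PSL2_proj_mulE !PSL2_proj_invE.
    exact: mul_inverted mV (involution_inv ixm) (involution_inv imy).
have iV := involution_inv ii.
have jE : j = (i * PSL2_proj eta)%g by rewrite etaE -{1}iV mulKg.
have kE : k = (PSL2_proj xi * i)%g by rewrite xiE -{2}iV mulgK.
suff iE : PSL2_proj m = i by rewrite jE kE -iE.
rewrite jE kE in ij ik; elim/PSL2_proj_ind: i ii ij ik {iV jE kE xiE etaE} => n *.
by apply: (orthogonal_uniq irr om); apply/orthogonal_involutions.
Qed.
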